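(* Let $\mathbb{K}$ be a field, $X$ a non-empty set, $R\subseteq \mathbb{K}\langle X\rangle$, $A=\mathbb{K}\langle X\rangle/I(R)$ an algebra augmented by $\varepsilon: A\to\mathbb{K}$, and $\prec$ a monomial order on $\langle X\rangle$. Let $V_M$ be the set of obstructions of the set $M$ of normal words. Then $V_M$ is the unique minimal set generating $\mathrm{LM}(I(R))$ as a monomial ideal. In particular, for any minimal non-commutative Gröbner basis $G$ of $I(R)$ (according to $\prec$), one has $V_M=\mathrm{LM}(G)$.
   Context: $\langle X\rangle$ is the free monoid on $X$ (words on the alphabet $X$, with empty word $1$), and $\mathbb{K}\langle X\rangle$ is the free associative unitary $\mathbb{K}$-algebra on $X$, which has $\langle X\rangle$ as a $\mathbb{K}$-basis. $I(R)$ is the two-sided ideal of $\mathbb{K}\langle X\rangle$ generated by $R$. For $g\in\mathbb{K}\langle X\rangle$, $\overline{g}$ denotes its image in $A=\mathbb{K}\langle X\rangle/I(R)$. The augmentation $\varepsilon:A\to\mathbb{K}$ is a surjective homomorphism of $\mathbb{K}$-algebras. A monomial order $\prec$ is a (total) well-order on $\langle X\rangle$ compatible with left and right multiplication: $u\prec v$ implies $wuw'\prec wvw'$ for all words $w,w'$. For a nonzero polynomial $f$, $\mathrm{LM}(f)$ is the $\prec$-greatest word appearing in $f$ with nonzero coefficient; for a set $F$ of polynomials, $\mathrm{LM}(F)=\{\mathrm{LM}(f) : f\in F,\ f\neq 0\}$. A word $u$ is a subword of (divides) a word $w$ if $w=aub$ for some words $a,b$ (contiguous factor); this is a well-founded partial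 order on $\langle X\rangle$. A monomial ideal is a subset $I\subseteq\langle X\rangle$ such that $uwv\in I$ whenever $w\in I$ and $u,v\in\langle X\rangle$; a set $S\subseteq I$ generates $I$ as a monomial ideal if every element of $I$ has an element of $S$ as a subword. A set generating $I$ is minimal if no proper subset of it generates $I$. A non-commutative Gröbner basis of a two-sided ideal $I$ (according to $\prec$) is a subset $G\subseteq I$ such that $\mathrm{LM}(G)$ generates $\mathrm{LM}(I)$ as a monomial ideal; it is minimal if no element of $\mathrm{LM}(G)$ is divisible by another element of $\mathrm{LM}(G)$. The set of normal words is $$M=\Big\{w\in\langle X\rangle : \text{for all } n \text{ and all } w_1,\dots,w_n\in\langle X\rangle \text{ with every } w_i\prec w, \text{ and all } \lambda_1,\dots,\lambda_n\in\mathbb{K},\ \overline{w}\neq\sum_{i=1}^n\lambda_i\overline{w_i}\Big\}.$$ The set of obstructions is the set of subword-minimal elements of the complement of $M$: $$V_M=\{y\in\langle X\rangle\setminus M : \text{no } x\in\langle X\rangle\setminus M \text{ is a proper subword of } y\}.$$ *)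

(* Defs.v *)
From HB Require Import structures.
From mathcomp Require Import all_boot all_order all_algebra.
From mathcomp Require Import finmap monalg.
From mathcomp Require Import boolp classical_sets.

Set Implicit Arguments.
Unset Strict Implicit.
Unset Printing Implicit Defensive.

Import GRing.Theory.
Local Open Scope ring_scope.
Local Open Scope quotient_scope.
Local Open Scope classical_set_scope.

Notation "u * v" := (mmul u v) : monom_scope.

(* The free monoid <X>; the empty word is [mone]. *)
Notation word X := {fmonom X}.

(* The free algebra K<X> is the monoid algebra of <X>; the basis vector
   attached to a word w is << w >>. *)
Notation free_alg K X := {malg K[word X]}.

Definition two_sided_ideal (A : pzRingType) (I : set A) : Prop :=
  [/\ I 0, forall f g, I f -> I g -> I (f + g)
    & forall a f b, I f -> I (a * f * b)].

Definition ideal_gen (A : pzRingType) (R : set A) : set A :=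
  smallest (@two_sided_ideal A) R.

Lemma ideal_genP (A : pzRingType) (R : set A) : two_sided_ideal (ideal_gen R).
Proof.
split=> [J [[J0 _ _] _] //|f g If Ig J JP|a f b If J JP].
  by have [[_ JD _] _] := JP; apply: JD; [apply: If | apply: Ig].
by have [[_ _ JM] _] := JP; apply: JM; apply: If.
Qed.

(* The quotient construction expects a boolean predicate. *)
Definition ideal_pred (A : pzRingType) (R : set A) : pred A :=
  fun f => `[< ideal_gen R f >].

Section IdealPred.
Variables (A : pzRingType) (R : set A).

Lemma ideal_genMl a f : ideal_gen R f -> ideal_gen R (a * f).
Proof.
by have [_ _ IM] := ideal_genP R; move=> /(IM a _ 1); rewrite mulr1.
Qed.

Lemma ideal_genMr b f : ideal_gen R f -> ideal_gen R (f * b).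
Proof.
by have [_ _ IM] := ideal_genP R; move=> /(IM 1 _ b); rewrite mul1r.
Qed.

Lemma ideal_pred_zmod_closed : zmod_closed (ideal_pred R).
Proof.
have [I0 ID _] := ideal_genP R; split=> [|f g /asboolP If /asboolP Ig].
  exact/asboolP.
have IN : ideal_gen R (- g) by rewrite -mulN1r; apply: ideal_genMl.
by apply/asboolP; apply: ID.
Qed.

HB.instance Definition _ :=
  GRing.isZmodClosed.Build A (ideal_pred R) ideal_pred_zmod_closed.

Definition ideal_closed : zmodClosed A :=
  GRing.ZmodClosed.clone A (ideal_pred R) _.

End IdealPred.

Section QuotientAlgebra.
Variables (K : fieldType) (X : choiceType) (R : set (free_alg K X)).

(* A = K<X> / I(R).  The quotient may be the zero ring, whereas the algebra
   structures of ssralg exclude it: the K-algebra structure of A is made of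
   its ring structure, its module structure and the lemmas [quo_scaleAl] and
   [quo_scaleAr]. *)
Definition quo_alg : Type := {ideal_quot ideal_closed R}.

HB.instance Definition _ := GRing.Zmodule.on quo_alg.
HB.instance Definition _ := Quotient.on quo_alg.

Definition quo_pi (f : free_alg K X) : quo_alg := \pi_quo_alg f.

Lemma quo_piP f g : quo_pi f = quo_pi g <-> ideal_gen R (f - g).
Proof.
split=> [/eqP|/asboolP Ifg]; first by rewrite -Quotient.idealrBE => /asboolP.
by apply/eqP; rewrite -Quotient.idealrBE.
Qed.

Lemma quo_pi_repr (x : quo_alg) : quo_pi (repr x) = x.
Proof. exact: reprK. Qed.

Lemma quo_piD f g : quo_pi (f + g) = quo_pi f + quo_pi g.
Proof. exact: (raddfD \pi_quo_alg). Qed.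

Definition quo_one : quo_alg := quo_pi 1.
Definition quo_mul (x y : quo_alg) : quo_alg := quo_pi (repr x * repr y).
Definition quo_scale (c : K) (x : quo_alg) : quo_alg := quo_pi (c *: repr x).

Lemma quo_pi_mul f g : quo_pi (f * g) = quo_mul (quo_pi f) (quo_pi g).
Proof.
apply/quo_piP; set f' := repr _; set g' := repr _.
have -> : f * g - f' * g' = (f - f') * g + f' * (g - g').
  by rewrite mulrBl mulrBr addrA subrK.
have [_ ID _] := ideal_genP R; apply: ID.
  by apply: ideal_genMr; apply/quo_piP; rewrite quo_pi_repr.
by apply: ideal_genMl; apply/quo_piP; rewrite quo_pi_repr.
Qed.

Lemma quo_pi_scale c f : quo_pi (c *: f) = quo_scale c (quo_pi f).
Proof.
apply/quo_piP; rewrite -scalerBr -mul_malgC.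
by apply: ideal_genMl; apply/quo_piP; rewrite quo_pi_repr.
Qed.

Lemma quo_mulA : associative quo_mul.
Proof.
move=> x y z; rewrite -(quo_pi_repr x) -(quo_pi_repr y) -(quo_pi_repr z).
by rewrite -!quo_pi_mul mulrA.
Qed.

Lemma quo_mul1l : left_id quo_one quo_mul.
Proof. by move=> x; rewrite -(quo_pi_repr x) -quo_pi_mul mul1r. Qed.

Lemma quo_mul1r : right_id quo_one quo_mul.
Proof. by move=> x; rewrite -(quo_pi_repr x) -quo_pi_mul mulr1. Qed.

Lemma quo_mulDl : left_distributive quo_mul +%R.
Proof.
move=> x y z; rewrite -(quo_pi_repr x) -(quo_pi_repr y) -(quo_pi_repr z).
by rewrite -quo_piD -!quo_pi_mul mulrDl quo_piD.
Qed.

Lemma quo_mulDr : right_distributive quo_mul +%R.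
Proof.
move=> x y z; rewrite -(quo_pi_repr x) -(quo_pi_repr y) -(quo_pi_repr z).
by rewrite -quo_piD -!quo_pi_mul mulrDr quo_piD.
Qed.

HB.instance Definition _ := GRing.Zmodule_isPzRing.Build quo_alg
  quo_mulA quo_mul1l quo_mul1r quo_mulDl quo_mulDr.

Lemma quo_scaleA a b x : quo_scale a (quo_scale b x) = quo_scale (a * b) x.
Proof. by rewrite -(quo_pi_repr x) -!quo_pi_scale scalerA. Qed.

Lemma quo_scale1 : left_id 1 quo_scale.
Proof. by move=> x; rewrite -(quo_pi_repr x) -quo_pi_scale scale1r. Qed.

Lemma quo_scaleDr : right_distributive quo_scale +%R.
Proof.
move=> a x y; rewrite -(quo_pi_repr x) -(quo_pi_repr y).
by rewrite -quo_piD -!quo_pi_scale scalerDr quo_piD.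
Qed.

Lemma quo_scaleDl x : {morph quo_scale^~ x : a b / a + b}.
Proof.
by move=> a b; rewrite -(quo_pi_repr x) -!quo_pi_scale scalerDl quo_piD.
Qed.

HB.instance Definition _ := GRing.Zmodule_isLmodule.Build K quo_alg
  quo_scaleA quo_scale1 quo_scaleDr quo_scaleDl.

Lemma quo_pi_zmod_morphism : zmod_morphism quo_pi.
Proof. exact: (raddfB \pi_quo_alg). Qed.

Lemma quo_pi_monoid_morphism : monoid_morphism quo_pi.
Proof. by split=> // f g; apply: quo_pi_mul. Qed.

HB.instance Definition _ := GRing.isZmodMorphism.Build (free_alg K X) quo_alg
  quo_pi quo_pi_zmod_morphism.
HB.instance Definition _ := GRing.isMonoidMorphism.Build (free_alg K X) quo_alg
  quo_pi quo_pi_monoid_morphism.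
HB.instance Definition _ := GRing.isScalable.Build K (free_alg K X) quo_alg
  *:%R quo_pi quo_pi_scale.

Lemma quo_scaleAl c (x y : quo_alg) : c *: (x * y) = (c *: x) * y.
Proof.
rewrite -(quo_pi_repr x) -(quo_pi_repr y).
by rewrite -rmorphM -!linearZ -rmorphM scalerAl.
Qed.

Lemma malg_scaleAr c (f g : free_alg K X) : c *: (f * g) = f * (c *: g).
Proof.
suff Uc : f * c%:MP = c *: f by rewrite -!mul_malgC mulrA mul_malgC -Uc mulrA.
rewrite -mul_malgC !malgM_def fgmulUg fgmulgU.
by apply/eq_bigr => w _; rewrite mul1m mulm1 mulrC.
Qed.

Lemma quo_scaleAr c (x y : quo_alg) : c *: (x * y) = x * (c *: y).
Proof.
rewrite -(quo_pi_repr x) -(quo_pi_repr y).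
by rewrite -rmorphM -!linearZ -rmorphM malg_scaleAr.
Qed.

End QuotientAlgebra.

(* Augmentation: surjective homomorphism of unital K-algebras. *)
Definition augmentation (K : fieldType) (X : choiceType)
    (R : set (free_alg K X)) (eps : {rmorphism quo_alg R -> K}) : Prop :=
  scalable_for *%R eps /\ (forall c : K, exists x, eps x = c).

Section Words.
Variable X : choiceType.
Implicit Types (u v w : word X) (S T I : set (word X)).

Record monomial_order (lt : word X -> word X -> Prop) : Prop := MonomialOrder {
  mo_irr : forall u, ~ lt u u;
  mo_trans : forall u v w, lt u v -> lt v w -> lt u w;
  mo_total : forall u v, [\/ lt u v, u = v | lt v u];
  mo_wf : well_founded lt;
  mo_compat : forall u v w w', lt u v -> lt (w * u * w')%M (w * v * w')%M
}.

Definition subword u w : Prop := exists a b, w = (a * u * b)%M.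

Definition proper_subword u w : Prop := subword u w /\ u <> w.

Definition monomial_ideal I : Prop :=
  forall u w v, I w -> I (u * w * v)%M.

Definition generates S I : Prop :=
  [/\ monomial_ideal I, S `<=` I
    & forall w, I w -> exists2 u, S u & subword u w].

Definition minimal_generating S I : Prop :=
  generates S I /\ (forall T, T `<` S -> ~ generates T I).

End Words.

Section Groebner.
Variables (K : fieldType) (X : choiceType) (lt : word X -> word X -> Prop).
Implicit Types (f : free_alg K X) (F G I R : set (free_alg K X)).

(* u is LM(f), the greatest word of the support of f. *)
Definition is_LM f (u : word X) : Prop :=
  u \in msupp f /\ (forall v, v \in msupp f -> v <> u -> lt v u).

Definition LM_set F : set (word X) :=
  [set u | exists f, [/\ F f, f != 0 & is_LM f u]].

Definition groebner_basis I G : Prop :=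
  G `<=` I /\ generates (LM_set G) (LM_set I).

Definition minimal_groebner_basis I G : Prop :=
  groebner_basis I G /\
  (forall u v, LM_set G u -> LM_set G v -> subword u v -> u = v).

Definition normal_words R : set (word X) :=
  [set w | forall (n : nat) (w_ : 'I_n -> word X) (lam : 'I_n -> K),
     (forall i, lt (w_ i) w) ->
     quo_pi R << w >> <> \sum_(i < n) lam i *: quo_pi R << w_ i >>].

End Groebner.

Definition obstructions (X : choiceType) (M : set (word X)) : set (word X) :=
  [set y | ~ M y /\ (forall x, ~ M x -> ~ proper_subword x y)].

(* Main.v *)
Require Import Defs.
From HB Require Import structures.
From mathcomp Require Import all_boot all_order all_algebra.
From mathcomp Require Import finmap monalg.
From mathcomp Require Import boolp classical_sets.

(** A word [w] is not normal exactly when [<< w >>] is congruent modulo I(R)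
    to a combination of smaller words; the difference then lies in I(R) and
    has leading word [w].  Conversely, dividing an element of I(R) by its
    leading coefficient and solving for the leading word gives such a
    congruence.  So the complement of M is LM(I(R))
    ([LM_set_ideal_genE]), and it is a monomial ideal because congruences may
    be multiplied by words on both sides ([nonnormal_monomial_ideal]).

    The rest holds for the set V of subword-minimal elements of any monomial
    ideal J.  The length of words makes the proper subword relation well
    founded, so V generates J ([obstructions_generate]).  A minimal element of
    J has no subword in J but itself, so every generating set contains V
    ([obstructions_sub_generating]).  Hence V is the least generating set,
    which is more than being the only minimal one.  If moreover the generating
    set is an antichain for the subword relation, as LM(G) is for a minimal
    Groebner basis G, it equals V ([generating_antichainE]). *)

Import GRing.Theory.
Local Open Scope ring_scope.
Local Open Scope classical_set_scope.

Section MonomialIdeals.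
Context {X : choiceType}.
Implicit Types (u v w : word X) (S J M : set (word X)).

Lemma subword_refl w : subword w w.
Proof. by exists mone, mone; rewrite mul1m mulm1. Qed.

Lemma subword_trans u v w : subword u v -> subword v w -> subword u w.
Proof.
move=> [a [b ->]] [c [d ->]]; exists (c * a)%M, (b * d)%M.
by rewrite !mulmA.
Qed.

Lemma proper_subword_size u w : proper_subword u w -> (size u < size w)%N.
Proof.
move=> [[a [b ->]]]; rewrite -!fdegE !fdegM => neq_u.
rewrite ltnNge; apply/negP; rewrite addnAC -[leqRHS]add0n leq_add2r leqn0.
rewrite addn_eq0 !fdeg_eq0 => /andP[/eqP a1 /eqP b1]; apply: neq_u.
by rewrite a1 b1 mul1m mulm1.
Qed.

Lemma obstruction_subwordE M u v :
  obstructions M v -> ~ M u -> subword u v -> u = v.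
Proof.
move=> [_ minv] nMu suv; apply: contrapT => neq_uv.
by apply: (minv u nMu).
Qed.

(** A shortest subword of [w] outside [M] is an obstruction. *)
Lemma obstruction_exists M w :
  ~ M w -> exists2 v, obstructions M v & subword v w.
Proof.
have [n] := ubnP (size w); elim: n w => // n IHn w le_w nMw.
have [Vw|nVw] := pselect (obstructions M w).
  by exists w => //; apply: subword_refl.
have [u nMu uw] : exists2 u, ~ M u & proper_subword u w.
  apply: contrapT => no_u; apply: nVw; split=> // u nMu uw.
  by apply: no_u; exists u.
have lt_u := leq_trans (proper_subword_size u w uw) le_w.
have [v Vv vu] := IHn u lt_u nMu.
by exists v => //; apply: subword_trans vu uw.1.
Qed.

Lemma obstructions_generate M :
  monomial_ideal (~` M) -> generates (obstructions M) (~` M).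
Proof. by split=> // [v []|w /obstruction_exists]. Qed.

(** The only subword of an obstruction lying outside [M] is itself. *)
Lemma obstructions_sub_generating M S :
  generates S (~` M) -> obstructions M `<=` S.
Proof.
move=> [_ sSM genS] v Vv; have [u Su uv] := genS v Vv.1.
by rewrite -(obstruction_subwordE _ _ _ Vv (sSM u Su) uv).
Qed.

Lemma obstructions_minimal_generating M :
  monomial_ideal (~` M) -> minimal_generating (obstructions M) (~` M).
Proof.
move=> idM; split=> [|S [_ nVS]]; first exact: obstructions_generate.
by move/obstructions_sub_generating.
Qed.

Lemma minimal_generating_unique M S :
  minimal_generating S (~` M) -> S = obstructions M.
Proof.
move=> [genS minS]; have [idM _ _] := genS.
have sVS := obstructions_sub_generating _ _ genS.
apply/seteqP; split=> //; apply: contrapT => nSV.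
by apply: (minS (obstructions M)) => //; apply: obstructions_generate.
Qed.

(** An element [s] of the antichain lies above some obstruction, which is
    itself in the antichain, hence equal to [s]. *)
Lemma generating_antichainE M S :
    generates S (~` M) ->
    (forall u v, S u -> S v -> subword u v -> u = v) ->
  obstructions M = S.
Proof.
move=> genS antiS; have [_ sSM _] := genS.
have sVS := obstructions_sub_generating _ _ genS.
apply/seteqP; split=> // s Ss.
have [v Vv vs] := obstruction_exists _ _ (sSM s Ss).
by rewrite -(antiS v s (sVS v Vv) Ss vs).
Qed.

End MonomialIdeals.

Section NormalWords.
Context {K : fieldType} {X : choiceType} (lt : word X -> word X -> Prop).
Context (lt_mo : monomial_order lt) (R : set (free_alg K X)).
Implicit Types (f : free_alg K X) (u v w : word X).

Lemma nonnormalP w :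
  (~ normal_words lt R w) <->
  exists n (w_ : 'I_n -> word X) (lam : 'I_n -> K),
    (forall i, lt (w_ i) w) /\
    quo_pi R << w >> = \sum_(i < n) lam i *: quo_pi R << w_ i >>.
Proof.
split=> [nMw|[n [w_ [lam [lt_w eq_w]]]] Mw]; last exact: (Mw n w_ lam).
apply: contrapT => no_sum; apply: nMw => n w_ lam lt_w eq_w.
by apply: no_sum; exists n, w_, lam.
Qed.

Lemma quo_pi_eq0 f : quo_pi R f = 0 <-> ideal_gen R f.
Proof. by rewrite -(raddf0 (quo_pi R)) quo_piP subr0. Qed.

Lemma malg_word_mul u v : << (u * v)%M >> = << u >> * << v >> :> free_alg K X.
Proof. by rewrite malgM_def fgmulUU mulr1. Qed.

Lemma malg_sum_words f : f = \sum_(v <- msupp f) f@_v *: << v >>.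
Proof.
rewrite [LHS]monalgE; apply: eq_bigr => v _; apply/malgP => u.
by rewrite mcoeffZ !mcoeffU mulr_natr.
Qed.

Lemma nonnormal_monomial_ideal : monomial_ideal (~` normal_words lt R).
Proof.
move=> a w b /nonnormalP[n [w_ [lam [lt_w eq_w]]]]; apply/nonnormalP.
exists n, (fun i => (a * w_ i * b)%M), lam; split=> [i|].
  exact: (mo_compat lt_mo).
rewrite !malg_word_mul !rmorphM /= eq_w mulr_sumr mulr_suml.
apply: eq_bigr => i _.
by rewrite !malg_word_mul !rmorphM /= -quo_scaleAr -quo_scaleAl.
Qed.

(** The support of the combination on the right of the congruence consists of
    words smaller than [w], so nothing cancels [w] in the difference. *)
Lemma nonnormal_LM w : ~ normal_words lt R w -> LM_set lt (ideal_gen R) w.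
Proof.
move=> /nonnormalP[n [w_ [lam [lt_w eq_w]]]].
pose g : free_alg K X := \sum_(i < n) lam i *: << w_ i >>.
have g_lt v : v \in msupp g -> lt v w.
  move=> gv; apply: contrapT => nlt_v; move: gv; rewrite -mcoeff_neq0.
  rewrite /g raddf_sum big1 ?eqxx // => i _; rewrite /= mcoeffZ mcoeffU.
  by case: eqP => [eq_v|_]; [case: nlt_v; rewrite -eq_v | rewrite mulr0].
have gw0 : g@_w = 0.
  by apply/eqP; rewrite mcoeff_eq0; apply/negP => /g_lt /(mo_irr lt_mo).
have fw : w \in msupp (<< w >> - g).
  by rewrite -mcoeff_neq0 mcoeffB mcoeffUU gw0 subr0 oner_eq0.
exists (<< w >> - g); split.
- apply/quo_piP; rewrite eq_w linear_sum.
  by apply: eq_bigr => i _; rewrite linearZ.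
- by apply/eqP => f0; rewrite f0 msupp0 in fw.
split=> // v /(fsubsetP (msuppB_le _ _)); rewrite in_fsetU msuppU1 in_fset1.
by case/orP => [/eqP //|/g_lt].
Qed.

(** Modulo the ideal, [f = 0] can be solved for its leading word. *)
Lemma LM_nonnormal w : LM_set lt (ideal_gen R) w -> ~ normal_words lt R w.
Proof.
move=> [f [/quo_pi_eq0 pf0 _ [fw fmax]]]; apply/nonnormalP.
(* The other words of the support of f, as a family indexed by an ordinal. *)
pose s := [seq v <- msupp f | v != w].
exists (size s), (tnth (in_tuple s)).
exists (fun i => - (f@_w)^-1 * f@_(tnth (in_tuple s) i)); split=> [i|].
  have := mem_tnth i (in_tuple s); rewrite mem_filter => /andP[/eqP neq_w fv].
  exact: fmax.
rewrite -(big_tnth _ _ s xpredT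
  (fun v => (- (f@_w)^-1 * f@_v) *: quo_pi R << v >>)) big_filter.
move: pf0; rewrite {1}[f]malg_sum_words linear_sum (bigD1_seq w fw (fset_uniq _)).
rewrite linearZ /= => /eqP; rewrite addr_eq0 => /eqP eq_w.
have fw0 : f@_w != 0 by rewrite mcoeff_neq0.
rewrite -[LHS](scalerK fw0) eq_w scalerN -scaleNr scaler_sumr.
by apply: eq_bigr => v _; rewrite linearZ scalerA.
Qed.

Lemma LM_set_ideal_genE : LM_set lt (ideal_gen R) = ~` normal_words lt R.
Proof.
by apply/seteqP; split=> w; [apply: LM_nonnormal | apply: nonnormal_LM].
Qed.

End NormalWords.

Theorem mainTheorem2 (K : fieldType) (X : choiceType)
    (X_nonempty : [set: X] !=set0)
    (R : set (free_alg K X))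
    (eps : {rmorphism quo_alg R -> K}) (eps_aug : augmentation eps)
    (lt : word X -> word X -> Prop) (lt_mo : monomial_order lt) :
  let I := ideal_gen R in
  let V := obstructions (normal_words lt R) in
  [/\ minimal_generating V (LM_set lt I),
      forall S : set (word X), minimal_generating S (LM_set lt I) -> S = V
    & forall G : set (free_alg K X),
        minimal_groebner_basis lt I G -> V = LM_set lt G].
Proof.
move=> I V; rewrite /minimal_groebner_basis /groebner_basis.
rewrite (LM_set_ideal_genE _ lt_mo); split=> [|S|G [[_ genG] antiG]].
- exact/obstructions_minimal_generating/nonnormal_monomial_ideal.
- exact: minimal_generating_unique.
exact: generating_antichainE.
Qed.
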